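(* Let $U\in\mathcal U(\mathcal H)$ be a unitary operator on a Hilbert space $\mathcal H$ and let $p\in\beta\mathbb N$ be an idempotent ultrafilter. Assume that $P\in\mathbb Z[x]$, $P(0)=0$ and $\deg P=N\ge1$. Assume moreover that $p\text{-}\lim_{n\in\mathbb N}U^{lP(n)}=0$ for all $l\ge 1$. Then $p\text{-}\lim_{n\in\mathbb N}U^{Q(n)}=0$ for all $Q\in\mathcal P_{\ge N}$.
   Context: $\mathbb N=\{1,2,\dots\}$. $\beta\mathbb N$ is the set of ultrafilters on $\mathbb N$, with addition defined by: $A\in p+q$ iff $\{n\in\mathbb N: A-n\in p\}\in q$, where $A-n=\{y\in\mathbb N: y+n\in A\}$. An ultrafilter $p$ is idempotent if $p+p=p$. For a sequence $(x_n)$ in a topological space, $p\text{-}\lim_{n\in\mathbb N}x_n=x$ means that $\{n\in\mathbb N: x_n\in O\}\in p$ for every open neighbourhood $O$ of $x$. For bounded operators on a Hilbert space, $p$-limits are taken in the weak operator topology. Hilbert spaces are complex and separable; $\mathcal U(\mathcal H)$ is the group of unitary operators on $\mathcal H$. $\mathcal P_{\ge N}$ is the set of polynomials $Q\in\mathbb Z[x]$ with $Q(0)=0$ and $\deg Q\ge N$. *)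

(* Defs.v *)
From HB Require Import structures.
From mathcomp Require Import all_boot all_order all_algebra.
From mathcomp Require Import complex.
From mathcomp Require Import all_classical all_reals all_analysis.

Set Implicit Arguments.
Unset Strict Implicit.
Unset Printing Implicit Defensive.

Import Order.TTheory GRing.Theory Num.Theory.
Import numFieldNormedType.Exports.

Local Open Scope classical_set_scope.
Local Open Scope ring_scope.

Definition posN := {n : nat | (0 < n)%N}.

Definition addp (m n : posN) : posN :=
  exist (fun k => (0 < k)%N) (val m + val n)%N (ltn_addr (val n) (valP m)).

(* The inner set is the shift A - n. *)
Definition uf_add (p q : set_system posN) : set_system posN :=
  [set A | q [set n | p [set x | A (addp x n)]]].

Lemma uf_add_ultra p q :
  UltraFilter p -> UltraFilter q -> UltraFilter (uf_add p q).
Proof.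
move=> up uq; split.
  split; first by rewrite /uf_add /=; move/filter_ex => [n]; move/filter_ex => [].
  split.
  - by rewrite /uf_add/=; apply: filterE => n; apply: filterE.
  - move=> A B; rewrite /uf_add /= => pA pB.
    by apply: filterS2 pA pB => n nA nB; exact: filterI.
  - move=> A B AB; rewrite /uf_add /=; apply: filterS => n.
    by apply: filterS => x; exact: AB.
move=> G PG sG; apply/seteqP; split=> // A GA.
have [//|nA] := in_ultra_setVsetC [set n | p [set x | A (addp x n)]] uq.
exfalso; have : uf_add p q (~` A).
  rewrite /uf_add /=; apply: filterS nA => n /= nA.
  by have [/nA//|] := in_ultra_setVsetC [set x | A (addp x n)] up.
by move=> /sG GnA; have [x []] := filter_ex (filterI GA GnA).
Qed.

Definition idempotent_uf (p : set_system posN) := uf_add p p = p.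

Definition plim (T : topologicalType) (p : set_system posN) (x : posN -> T)
  (l : T) := forall O : set T, open_nbhs l O -> p [set n | O (x n)].

Lemma plimP (T : topologicalType) (p : set_system posN) (x : posN -> T)
    (l : T) :
  Filter p -> plim p x l <-> x @ p --> l.
Proof.
move=> Fp; split=> [h A|h O].
  rewrite nbhsE; case=> O oO OA; apply: filterS (h O oO) => n; exact: OA.
by move=> /open_nbhs_nbhs /h.
Qed.

HB.mixin Record isHilbert (R : realType) H of CompleteNormedModule R[i] H := {
  inner : H -> H -> R[i] ;
  inner_linearl : forall (a : R[i]) (x y z : H),
    inner (a *: x + y) z = a * inner x z + inner y z ;
  inner_conj : forall x y : H, inner x y = (inner y x)^* ;
  innerE : forall x : H, inner x x = `|x| ^+ 2
}.

#[short(type="hilbertType")]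
HB.structure Definition Hilbert (R : realType) :=
  {H of CompleteNormedModule R[i] H & isHilbert R H}.

Definition separable (T : topologicalType) :=
  exists2 D : set T, countable D & dense D.

Section InnerProduct.
Variables (R : realType) (H : hilbertType R).

Fact inner_bilinear :
  bilinear_for *%R (Num.conj \; *%R) (@inner R H).
Proof.
split=> [z a x y|x a y z]; first exact: inner_linearl.
by rewrite inner_conj inner_linearl rmorphD rmorphM /= -!inner_conj.
Qed.

HB.instance Definition _ :=
  @bilinear_isBilinear.Build R[i] H H R[i] *%R (Num.conj \; *%R)
    (@inner R H) inner_bilinear.

Fact inner_hermitian (x y : H) :
  inner x y = (-1) ^+ false * Num.conj (inner y x).
Proof. by rewrite mul1r -inner_conj. Qed.

HB.instance Definition _ :=
  @isHermitianSesquilinear.Build R[i] H false Num.conj (@inner R H)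
    inner_hermitian.

Fact inner_gt0 (x : H) : x != 0 -> 0 < inner x x.
Proof. by move=> x0; rewrite innerE exprn_gt0 ?normr_gt0. Qed.

HB.instance Definition _ := @isDotProduct.Build R[i] H (@inner R H) inner_gt0.

End InnerProduct.

Section BoundedOperators.
Variables (R : realType) (H : hilbertType R).

Record bounded_op := BoundedOp {
  op_fun :> H -> H ;
  op_linear : linear op_fun ;
  op_bounded : bounded_near op_fun (nbhs (0 : H)) }.

HB.instance Definition _ (A : bounded_op) :=
  GRing.isLinear.Build R[i] H H *:%R (op_fun A) (@op_linear A).

Lemma bounded_opP (A B : bounded_op) : A =1 B -> A = B.
Proof.
case: A B => [A lA bA] [B lB bB] /= /funext AB.
by case: _ / AB in lB bB *; congr BoundedOp; exact: Prop_irrelevance.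
Qed.

Lemma op_continuous (A : bounded_op) : continuous A.
Proof. exact/linear_bounded_continuous/op_bounded. Qed.

Fact op0_linear : linear (fun _ : H => 0 : H).
Proof. by move=> a x y; rewrite scaler0 addr0. Qed.

Fact op0_bounded : bounded_near (fun _ : H => 0 : H) (nbhs (0 : H)).
Proof.
by apply/(@linear_bounded_continuous R[i] H H (\0 : {linear H -> H})) => x;
  exact: cvg_cst.
Qed.

Definition op0 := BoundedOp op0_linear op0_bounded.

Fact op1_linear : linear (@id H). Proof. by []. Qed.

Fact op1_bounded : bounded_near (@id H) (nbhs (0 : H)).
Proof.
by apply/(@linear_bounded_continuous R[i] H H (idfun : {linear H -> H})) => x;
  exact: cvg_id.
Qed.

Definition op1 := BoundedOp op1_linear op1_bounded.

Fact opM_linear (A B : bounded_op) : linear (A \o B).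
Proof. by move=> a x y; rewrite /= !linearP. Qed.

Fact opM_bounded (A B : bounded_op) : bounded_near (A \o B) (nbhs (0 : H)).
Proof.
apply/(@linear_bounded_continuous R[i] H H (A \o B : {linear H -> H})) => x.
by apply: continuous_comp; exact: op_continuous.
Qed.

Definition opM A B := BoundedOp (opM_linear A B) (opM_bounded A B).

Definition adjoint (A B : bounded_op) := forall x y : H,
  inner (A x) y = inner x (B y).

Definition unitary (A : bounded_op) :=
  exists B, [/\ adjoint A B, opM A B = op1 & opM B A = op1].

Record unitary_op := UnitaryOp {
  uop :> bounded_op ;
  uopP : unitary uop }.

HB.instance Definition _ := gen_eqMixin unitary_op.
HB.instance Definition _ := gen_choiceMixin unitary_op.

Lemma unitary_opP (U V : unitary_op) : U =1 V -> U = V.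
Proof.
case: U V => [U uU] [V uV] /= /bounded_opP UV.
by case: _ / UV in uV *; congr UnitaryOp; exact: Prop_irrelevance.
Qed.

Fact uop1_unitary : unitary op1.
Proof. by exists op1; split=> //; exact: bounded_opP. Qed.

Definition uop1 := UnitaryOp uop1_unitary.

Fact uopM_unitary (U V : unitary_op) : unitary (opM U V).
Proof.
have [A [aA UA AU]] := uopP U; have [B [aB VB BV]] := uopP V.
have opE (X Y : bounded_op) : opM X Y = op1 -> forall x, X (Y x) = x.
  by move=> XY x; rewrite -[RHS]/(op1 x) -XY.
exists (opM B A); split; first by move=> x y /=; rewrite aA aB.
- by apply: bounded_opP => x /=; rewrite (opE _ _ VB) (opE _ _ UA).
- by apply: bounded_opP => x /=; rewrite (opE _ _ AU) (opE _ _ BV).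
Qed.

Definition uopM U V := UnitaryOp (uopM_unitary U V).

Definition uadj (U : unitary_op) : bounded_op := projT1 (cid (uopP U)).

Lemma uadjP (U : unitary_op) :
  [/\ adjoint U (uadj U), opM U (uadj U) = op1 & opM (uadj U) U = op1].
Proof. exact: projT2 (cid (uopP U)). Qed.

Fact uadj_unitary (U : unitary_op) : unitary (uadj U).
Proof.
exists U; have [aU UV VU] := uadjP U; split=> // x y.
by rewrite inner_conj -aU -inner_conj.
Qed.

Definition uopV U := UnitaryOp (uadj_unitary U).

Fact uopA : associative uopM. Proof. by move=> U V W; exact: unitary_opP. Qed.
Fact uop1g : left_id uop1 uopM. Proof. by move=> U; exact: unitary_opP. Qed.
Fact uopg1 : right_id uop1 uopM. Proof. by move=> U; exact: unitary_opP. Qed.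

Fact uopVg : left_inverse uop1 uopV uopM.
Proof.
move=> U; have [_ _ VU] := uadjP U; apply: unitary_opP => x.
by rewrite -[RHS]/(op1 x) -VU.
Qed.

Fact uopgV : right_inverse uop1 uopV uopM.
Proof.
move=> U; have [_ UV _] := uadjP U; apply: unitary_opP => x.
by rewrite -[RHS]/(op1 x) -UV.
Qed.

HB.instance Definition _ :=
  isGroup.Build unitary_op uopA uop1g uopg1 uopVg uopgV.

End BoundedOperators.

Arguments op0 {R H}.

(* Negz n is the integer - n.+1. *)
Definition gexpz (G : groupType) (x : G) (k : int) : G :=
  match k with Posz n => (x ^+ n)%g | Negz n => (x ^- n.+1)%g end.

(* The weak operator topology is the coarsest one making all the matrix
   coefficients A |-> <A x, y> continuous. *)
Definition matrix_coef (R : realType) (H : hilbertType R) (A : bounded_op H) :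
    {ptws (H * H)%type -> R[i]^o} :=
  fun xy => inner (A xy.1) xy.2.

Definition wot (R : realType) (H : hilbertType R) := bounded_op H.

HB.instance Definition _ (R : realType) (H : hilbertType R) :=
  gen_eqMixin (bounded_op H).
HB.instance Definition _ (R : realType) (H : hilbertType R) :=
  gen_choiceMixin (bounded_op H).
HB.instance Definition _ (R : realType) (H : hilbertType R) :=
  Topological.copy (wot H) (initial_topology (@matrix_coef R H)).

Definition poly_ge (N : nat) : set {poly int} :=
  [set Q | Q.[0] = 0 /\ (N < size Q)%N].

(* Main.v *)
Require Import Defs.
From mathcomp Require Import all_boot all_order all_algebra.
From mathcomp Require Import complex.
From mathcomp Require Import all_classical all_reals all_analysis.
From mathcomp Require Import ring lra zify.

Set Implicit Arguments.
Unset Strict Implicit.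
Unset Printing Implicit Defensive.

Import Order.TTheory GRing.Theory Num.Theory.
Import numFieldNormedType.Exports.

Local Open Scope classical_set_scope.
Local Open Scope ring_scope.

(** If [Q] has degree [N] and [a], [b] are the leading coefficients of [P], [Q],
    then [aQ] and [bP] have the same leading term, so one wants to say that
    [U^(Q(n)) x] staying close to [x] forces the same for multiples of [P], up
    to polynomials of smaller degree; the point of the proof is to organise
    these lower order terms.  Call [x] rigid for [T] if [p]-lim [U^(T(n)) x = x]
    (weakly, hence in norm, all these vectors having the same length: [rigidP])
    and null for [T] if this limit is [0].  Let [level j] be the space of vectors that are, for some [l > 0],
    rigid for all [l G] with [G(0) = 0] and [deg G <= j].  These spaces decrease
    from [level 0 = H].

    Two facts hold for [T(0) = 0] and [deg T = d + 1].
    - The weak limit of [U^(T(n))] maps [level d] to [level (d + 1)]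
      ([level_wlim]).  Idempotence of [p] allows [n] to be replaced by [n + h],
      with [h] divisible by [l] ([idempotent_dvdn]); then
      [T(n + h) - T(n) - T(h) = h G(n)] with [deg G <= d] acts trivially in the
      limit on [level d], and the limit operator is idempotent there
      ([wlim_idempotent]): its values are rigid for [T].
    - So a vector in the closure of [level d] and orthogonal to [level (d + 1)]
      is null for [T] ([orthogonal_null]); by van der Corput's trick along [p]
      ([van_der_corput]) it is null for all polynomials of degree at least
      [d + 1] that vanish at [0] ([null_above]).

    If every multiple [l P] with [l >= 1] gives the limit [0], then a vector of
    [level N] is both rigid and null for some [l P], so [level N = 0].
    Splitting [H] along the closures of [level 0], ..., [level N] by orthogonal
    projection, each summand is null for every [Q] of degree at least [N]
    ([adherent_level_null]).

    Only the real part of the inner product is used: it turns [H] into a real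
    Hilbert space on which the powers of [U] act by isometries.  Both the
    orthogonal projections and the weak limits come from one minimisation
    argument ([riesz_adherent]). *)

(** * The underlying real Hilbert space *)

Section RealHilbert.
Variables (R : realType) (H : hilbertType R).
Implicit Types (x y z v : H) (a e : R).

Definition rinner x y : R := complex.Re (inner x y).
Definition sqn x : R := rinner x x.

Lemma rinnerC x y : rinner x y = rinner y x.
Proof. by rewrite /rinner inner_conj; case: (inner y x). Qed.

Lemma rinnerDl x y z : rinner (x + y) z = rinner x z + rinner y z.
Proof.
rewrite /rinner -[x in LHS]scale1r inner_linearl mul1r.
by case: (inner x z) => ??; case: (inner y z).
Qed.

Lemma rinner0l z : rinner 0 z = 0.
Proof. by apply: (addrI (rinner 0 z)); rewrite -rinnerDl !addr0. Qed.

Lemma rinnerZl a x z : rinner (a%:C%C *: x) z = a * rinner x z.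
Proof.
rewrite /rinner -[a%:C%C *: x]addr0 inner_linearl.
have -> : complex.Re (a%:C%C * inner x z + inner 0 z) =
   complex.Re (a%:C%C * inner x z) + rinner 0 z.
  by rewrite /rinner; case: (_ * _) => ??; case: (inner 0 z).
rewrite rinner0l addr0; case: (inner x z) => u v /=.
by rewrite mul0r subr0.
Qed.

Lemma rinnerNl x z : rinner (- x) z = - rinner x z.
Proof. by apply: (addrI (rinner x z)); rewrite -rinnerDl !subrr rinner0l. Qed.

Lemma rinnerDr x y z : rinner z (x + y) = rinner z x + rinner z y.
Proof. by rewrite rinnerC rinnerDl ![rinner _ z]rinnerC. Qed.

Lemma rinnerZr a x z : rinner z (a%:C%C *: x) = a * rinner z x.
Proof. by rewrite rinnerC rinnerZl rinnerC. Qed.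

Lemma rinnerNr x z : rinner z (- x) = - rinner z x.
Proof. by rewrite rinnerC rinnerNl rinnerC. Qed.

Definition rinnerE :=
  (rinnerDl, rinnerDr, rinnerNl, rinnerNr, rinnerZl, rinnerZr).

Lemma sqnE x : (sqn x)%:C%C = `|x| ^+ 2.
Proof.
rewrite /sqn /rinner innerE; apply: RRe_real.
by rewrite realX // ger0_real.
Qed.

Lemma sqn_ge0 x : 0 <= sqn x.
Proof. by rewrite -ler0c sqnE exprn_ge0. Qed.

Lemma sqn_eq0 x : sqn x = 0 -> x = 0.
Proof.
move=> q0; have : `|x| ^+ 2 == 0 by rewrite -sqnE q0.
by rewrite expf_eq0 /= normr_eq0 => /eqP.
Qed.

Lemma sqnN x : sqn (- x) = sqn x.
Proof. by rewrite /sqn !rinnerE opprK. Qed.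

Lemma sqnZ a x : sqn (a%:C%C *: x) = a ^+ 2 * sqn x.
Proof. by rewrite /sqn !rinnerE mulrA. Qed.

Lemma sqnD x y : sqn (x + y) = sqn x + 2 * rinner x y + sqn y.
Proof. rewrite /sqn !rinnerE [rinner y x]rinnerC; ring. Qed.

Lemma sqnB x y : sqn (x - y) = sqn x - 2 * rinner x y + sqn y.
Proof. rewrite /sqn !rinnerE [rinner y x]rinnerC; ring. Qed.

Lemma sqnD_le x y : sqn (x + y) <= 2 * sqn x + 2 * sqn y.
Proof. have := sqn_ge0 (x - y); rewrite sqnB sqnD; lra. Qed.

Lemma cauchy_schwarz x y : rinner x y ^+ 2 <= sqn x * sqn y.
Proof.
have := sqn_ge0 x; rewrite le_eqVlt => /orP[/eqP/esym/[dup]qx0/sqn_eq0 ->|x0].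
  by rewrite rinner0l expr0n /= /sqn rinner0l mul0r.
have := sqn_ge0 ((sqn x)%:C%C *: y - (rinner x y)%:C%C *: x).
rewrite sqnB /sqn !rinnerE -/(sqn _) -/(sqn _) [rinner y x]rinnerC => h.
have : 0 <= sqn x * (sqn x * sqn y - rinner x y ^+ 2) by nra.
by rewrite pmulr_rge0 // subr_ge0.
Qed.

Lemma norm_lt_sqn x e : 0 < e -> sqn x < e ^+ 2 -> `|x| < e%:C%C.
Proof.
move=> e0 h; rewrite -ltr_sqr ?nnegrE ?ler0c ?(ltW e0) //.
by rewrite -sqnE -rmorphXn ltcR.
Qed.

Lemma sqn_lt_norm x e : 0 < e -> `|x| < e%:C%C -> sqn x < e ^+ 2.
Proof.
move=> e0; rewrite -ltr_sqr ?nnegrE ?ler0c ?(ltW e0) //.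
by rewrite -sqnE -rmorphXn ltcR.
Qed.

(** Membership in the norm closure of [E]. *)
Definition adherent (E : set H) y :=
  forall e, 0 < e -> exists2 v, E v & sqn (y - v) < e.

Lemma sqn_complete (u : nat -> H) :
  (forall m n, sqn (u m - u n) <= 2 / m.+1%:R + 2 / n.+1%:R) ->
  exists y, forall e, 0 < e -> \forall n \near \oo, sqn (y - u n) < e.
Proof.
move=> cu; have : cauchy (u @ \oo).
  apply: cauchy_exP => e e0.
  have [d d0 de] : exists2 d : R, 0 < d & e = d%:C%C.
    exists (complex.Re e); first by move: e0; rewrite ltcE => /andP[].
    by rewrite RRe_real // gtr0_real.
  have d2 : 0 < d ^+ 2 / 4 by rewrite divr_gt0 ?exprn_gt0.
  have [N _ NP] := near_infty_natSinv_lt (PosNum d2).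
  exists (u N); exists N => // n /= Nn; rewrite -ball_normE /= de.
  apply: norm_lt_sqn => //; apply: le_lt_trans (cu _ _) _.
  have := NP N (leqnn N); have := NP n Nn; rewrite /=.
  by move: (n.+1%:R^-1) (N.+1%:R^-1) => a b; lra.
move/cauchy_cvg => /cvg_ex [y uy]; exists y => e e0.
have se : 0 < Num.sqrt e by rewrite sqrtr_gt0.
have := @cvgr_dist_lt _ _ _ _ _ _ _ uy (Num.sqrt e)%:C%C.
rewrite (ltcR 0) => /(_ _ se); apply: filterS => n /(sqn_lt_norm se).
by rewrite sqr_sqrtr // ltW.
Qed.

(** Minimise [J v = |v|^2 - 2 f v] over [E]: by the parallelogram law minimising
    sequences are Cauchy, and the first order condition at the limit [y] is
    [f v = <y, v>].  For [E] the whole space this is the Riesz representation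
    theorem; for [f = <x, _>] it gives the orthogonal projection of [x] on the
    closure of [E]. *)
Lemma riesz_adherent (E : set H) (f : H -> R) (C : R) :
  E 0 -> (forall x y, E x -> E y -> E (x + y)) ->
  (forall a x, E x -> E (a%:C%C *: x)) ->
  (forall x y, E x -> E y -> f (x + y) = f x + f y) ->
  (forall a x, E x -> f (a%:C%C *: x) = a * f x) ->
  0 <= C -> (forall x, E x -> f x ^+ 2 <= C * sqn x) ->
  exists2 y, adherent E y & forall v, E v -> f v = rinner y v.
Proof.
move=> E0 ED EZ fD fZ C0 fC; pose J v := sqn v - 2 * f v.
have Jlb v : E v -> - C <= J v.
  move=> Ev; rewrite /J; have := fC v Ev; have := sqn_ge0 v => q0 fle.
  rewrite leNgt; apply/negP => h.
  have : (sqn v + C) ^+ 2 < (2 * f v) ^+ 2 by rewrite ltr_sqr ?nnegrE; lra.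
  have := sqr_ge0 (sqn v - C); nra.
have Jinf : has_inf (J @` E).
  by split; [exists (J 0), 0 | exists (- C) => _ [v Ev <-]; exact: Jlb].
pose m := inf (J @` E).
have mJ v : E v -> m <= J v.
  by move=> Ev; apply: ge_inf; [exact: Jinf.2 | exists v].
have /choice [w wP] (n : nat) : exists v, E v /\ J v < m + n.+1%:R^-1.
  have [|_ [v Ev <-] lv] := @inf_adherent _ _ n.+1%:R^-1 _ Jinf.
    by rewrite invr_gt0.
  by exists v.
have [|y wy] := @sqn_complete w.
  move=> i j; have [Ei Ji] := wP i; have [Ej Jj] := wP j.
  have := mJ _ (EZ (2^-1) _ (ED _ _ Ei Ej)); move: Ji Jj.
  rewrite /J fZ ?fD //; last exact: ED.
  rewrite /sqn !rinnerE -!/(sqn _) [rinner (w j) (w i)]rinnerC.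
  by move: (i.+1%:R^-1) (j.+1%:R^-1) => a b; lra.
exists y => [e e0|v Ev].
  have [n _ nP] := wy e e0; exists (w n); first exact: (wP n).1.
  exact: nP (leqnn n).
have q1 : 0 < sqn v + 1 by have := sqn_ge0 v; lra.
(* J (w n + t v) >= m with t = - g / (|v|^2 + 1), where g = <w n, v> - f v. *)
have first_order n : (rinner (w n) v - f v) ^+ 2 <= n.+1%:R^-1 * (sqn v + 1).
  have [En Jn] := wP n; set g := _ - _.
  have := mJ _ (ED _ _ En (EZ (- g / (sqn v + 1)) _ Ev)).
  move: Jn; rewrite /J fD ?fZ //; last exact: EZ.
  rewrite sqnD sqnZ rinnerZr => h1 h2.
  rewrite -ler_pdivrMr //; set t := (sqn v + 1)^-1 in h1 h2 *.
  have tq : t * (sqn v + 1) = 1 by rewrite mulVf // lt0r_neq0.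
  have t0 : 0 < t by rewrite invr_gt0.
  have : m <= J (w n) + (- 2 * g ^+ 2 * t + g ^+ 2 * t * (t * sqn v)).
    apply: le_trans h2 _; rewrite le_eqVlt; apply/orP; left; apply/eqP.
    rewrite /J /g; ring.
  have -> : t * sqn v = 1 - t by rewrite -tq; ring.
  have := mulr_ge0 (mulr_ge0 (sqr_ge0 g) (ltW t0)) (ltW t0).
  move: h1; rewrite /J; move: (n.+1%:R^-1) => b; lra.
apply/eqP; rewrite eq_sym -subr_eq0 -sqrf_eq0 eq_le sqr_ge0 andbT.
apply/ler_addgt0Pr => e e0; rewrite add0r.
have ee : 0 < e / (4 * (sqn v + 1)) by rewrite divr_gt0 // mulr_gt0.
near \oo => n.
have [] : n.+1%:R^-1 < e / (4 * (sqn v + 1)) /\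
    sqn (y - w n) < e / (4 * (sqn v + 1)).
  split; near: n; last exact: wy.
  exact: (near_infty_natSinv_lt (PosNum ee)).
have := first_order n; have := cauchy_schwarz (y - w n) v.
rewrite rinnerDl rinnerNl !ltr_pdivlMr ?mulr_gt0 // => h1 h2 h3 h4.
have q0 := sqn_ge0 v; have := sqn_ge0 (y - w n).
move: h1 h2 h3 h4; set a := rinner y v; set b := rinner (w n) v.
set d := _^-1; set s := sqn (y - _) => h1 h2 h3 h4 s0.
have := sqr_ge0 ((a - b) - (b - f v)); nra.
Unshelve. all: by end_near.
Qed.

End RealHilbert.

(** * Limits along an idempotent ultrafilter *)

Lemma ultra_bounded_cvg (R : realType) (p : set_system posN) (f : posN -> R)
    (M : R) : UltraFilter p ->
  (forall n, `|f n| <= M) -> exists L : R, f n @[n --> p] --> L.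
Proof.
move=> up fM; have pM : p (f @^-1` `[- M, M]%classic).
  by apply: filterE => n /=; rewrite in_itv /= -ler_norml; exact: fM.
have [L [_ cL]] := @segment_compact R (- M) M (f @ p) _ pM.
exists L => A AL; have [//|nA] := in_ultra_setVsetC (f @^-1` A) up.
by have [r []] := cL (~` A) A nA AL.
Qed.

Lemma idempotent_near (p : set_system posN) (A : set posN) :
  idempotent_uf p -> p A -> \forall h \near p, \forall n \near p, A (addp n h).
Proof. by move=> ip; rewrite -{1}ip. Qed.

(** Exactly one residue class [i] modulo [l] belongs to [p]; idempotence gives
    [i + i = i], so it is the class of [0]. *)
Lemma idempotent_dvdn (p : set_system posN) (l : nat) :
  UltraFilter p -> idempotent_uf p -> (0 < l)%N ->
  \forall h \near p, (l %| val h)%N.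
Proof.
move=> up ip l0; pose A (i : 'I_l) : set posN := [set n | val n = i %[mod l]].
have [i pAi] : exists i, p (A i).
  apply: contrapT => /forallNP nA.
  have : \forall n \near p, forall i, (~` A i) n.
    by apply: filter_forall => i; have [/nA|] := in_ultra_setVsetC (A i) up.
  case/filter_ex => n /(_ (Ordinal (ltn_pmod (val n) l0))); apply.
  by rewrite /A /= modn_mod.
have [h [Ah [n [An Anh]]]] :
    exists h, A i h /\ exists n, A i n /\ A i (addp n h).
  have [h [Ah]] := filter_ex (filterI pAi (idempotent_near ip pAi)).
  by move/(filterI pAi) => /filter_ex [n [? ?]]; exists h; split=> //; exists n.
have i0 : i = 0 %[mod l].
  apply/eqP; rewrite -(eqn_modDl i) addn0; apply/eqP.
  by move: Anh; rewrite /A /= -modnDm An Ah modnDm.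
by apply: filterS pAi => m Am; apply/eqP; rewrite Am i0 mod0n.
Qed.

(** * Van der Corput's trick *)

Section VanDerCorput.
Variables (R : realType) (H : hilbertType R) (p : set_system posN).
Hypotheses (up : UltraFilter p) (ip : idempotent_uf p).
Variables (x : posN -> H) (M : R).
Hypothesis xM : forall n, sqn (x n) <= M.
Hypothesis xx : forall h, rinner (x (addp n h)) (x n) @[n --> p] --> (0 : R).

Let block (s : seq posN) n := \sum_(h <- s) x (addp n h).

Lemma block_correlation s : rinner (block s n) (x n) @[n --> p] --> (0 : R).
Proof.
elim: s => [|h s IH].
  by under eq_fun do rewrite /block big_nil rinner0l; exact: cvg_cst.
rewrite -[0]addr0; under eq_fun do rewrite /block big_cons rinnerDl.
exact: cvgD.
Qed.

Lemma block_extend s h n :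
  block (h :: map (addp^~ h) s) n = block s (addp n h) + x (addp n h).
Proof.
rewrite /block big_cons addrC; congr (_ + _); rewrite big_map.
apply: eq_bigr => k _; congr x; apply/val_inj => /=; lia.
Qed.

(** A block with one more translate arises from [block s + x] by a shift through
    a suitable [h], which exists because [p] is idempotent.  The new term is
    nearly orthogonal to [block s], so squared lengths grow at most linearly in
    the number [k] of terms, while the pairings with [z] grow at least at rate
    [d]. *)
Lemma large_block z d k : (\forall n \near p, d <= rinner (x n) z) ->
  exists s, \forall n \near p,
    sqn (block s n) <= k%:R * (M + 1) /\ k%:R * d <= rinner (block s n) z.
Proof.
move=> xd; elim: k => [|k [s IH]].
  exists [::]; apply: filterE => n.
  by rewrite /block big_nil /sqn !rinner0l !mul0r.
have big : \forall n \near p, sqn (block s n + x n) <= k.+1%:R * (M + 1) /\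
    k.+1%:R * d <= rinner (block s n + x n) z.
  have ort : \forall n \near p, `|rinner (block s n) (x n)| < 1 / 2.
    have := block_correlation s => /cvgr_norm_lt; apply.
    by rewrite normr0; lra.
  near=> n; have [] : sqn (block s n) <= k%:R * (M + 1) /\
    k%:R * d <= rinner (block s n) z by near: n.
  have : `|rinner (block s n) (x n)| < 1 / 2 by near: n.
  have : d <= rinner (x n) z by near: n.
  rewrite sqnD rinnerDl -[k.+1%:R]natr1; move: (k%:R) => c.
  by move=> h1 /ltr_normlW h2 h3 h4; have := xM n; split; lra.
have [h hP] := filter_ex (idempotent_near ip big).
exists (h :: map (addp^~ h) s); apply: filterS hP => n.
by rewrite block_extend.
Unshelve. all: by end_near.
Qed.

(** Otherwise, for [w = z] or [w = - z], [large_block] yields vectors [b] with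
    [|b|^2 <= k (M + 1)] and [<b, w> >= k e] for every [k]; for large [k] this
    contradicts the Cauchy-Schwarz inequality. *)
Lemma van_der_corput z : rinner (x n) z @[n --> p] --> (0 : R).
Proof.
have M0 : 0 <= M by apply: le_trans (xM (exist _ 1%N isT)); exact: sqn_ge0.
have key w e : 0 < e -> ~ \forall n \near p, e <= rinner (x n) w.
  move=> e0 /large_block xe.
  pose k := (Num.truncn ((M + 1) * sqn w / e ^+ 2)).+1.
  have [s /filter_ex[n [b1 b2]]] := xe k.
  have k0 : 0 < k%:R :> R by rewrite ltr0n.
  have kP : (M + 1) * sqn w < k%:R * e ^+ 2.
    rewrite -ltr_pdivrMr ?exprn_gt0 //; exact: truncnS_gt.
  have : (k%:R * e) ^+ 2 <= rinner (block s n) w ^+ 2.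
    by rewrite ler_sqr ?nnegrE // ?(le_trans _ b2) ?mulr_ge0 // ltW.
  move/le_trans/(_ (cauchy_schwarz _ _))/le_trans.
  move/(_ _ (ler_wpM2r (sqn_ge0 w) b1)).
  by rewrite expr2 -!mulrA ler_pM2l // leNgt mulrCA -expr2 kP.
apply/cvgrPdist_lt => e e0.
have [//|nA] := in_ultra_setVsetC [set n | `|0 - rinner (x n) z| < e] up.
have [ge|nge] := in_ultra_setVsetC [set n | e <= rinner (x n) z] up.
  by have [] := key z e e0.
have [] := key (- z) e e0; apply: filterS2 nA nge => n /= /negP + /negP.
rewrite rinnerNr sub0r normrN -leNgt -ltNge ler_normr.
by move=> /orP[/le_lt_trans h /h|//]; rewrite ltxx.
Qed.

End VanDerCorput.

(** * Integer powers and differences of polynomials *)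

Lemma gexpz_sub (G : groupType) (x : G) (m n : nat) :
  gexpz x (m%:Z - n%:Z) = (x ^+ m * x ^- n)%g.
Proof.
have [le_nm|/ltnW le_mn] := leqP n m; first by rewrite subzn // -expgnFr.
have -> : m%:Z - n%:Z = - (n - m)%:Z by rewrite -subzn // opprB.
have -> : gexpz x (- (n - m)%:Z) = (x ^- (n - m))%g.
  by case: (n - m)%N => [|k] //=; rewrite expg0 invg1.
by rewrite expgnFr // invgM invgK.
Qed.

Lemma gexpzD (G : groupType) (x : G) (j k : int) :
  gexpz x (j + k) = (gexpz x j * gexpz x k)%g.
Proof.
have intE (i : int) : exists m n : nat, i = m%:Z - n%:Z.
  case: i => n; first by exists n, 0%N; rewrite subr0.
  by exists 0%N, n.+1; rewrite NegzE sub0r.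
have [m [n ->]] := intE j; have [m' [n' ->]] := intE k.
have -> : m%:Z - n%:Z + (m'%:Z - n'%:Z) = (m + m')%:Z - (n' + n)%:Z by lia.
rewrite !gexpz_sub !expgnDr invgM !mulgA; congr (_ * _)%g; rewrite -!mulgA.
by congr (_ * _)%g; apply: commuteV; apply: commuteX2.
Qed.

(** Taylor's formula at [n].  Here [deg T = d + 1], and for [d > 0] the
    coefficient of degree [d] of [G] is [d + 1] times the leading coefficient of
    [T]; for [d = 0] it is lost with the constant term, and [G] is zero. *)
Lemma poly_shift (T : {poly int}) (h : int) (d : nat) :
  T.[0] = 0 -> size T = d.+2 ->
  exists G : {poly int}, [/\ G.[0] = 0, (size G <= d.+1)%N,
    ((0 < d)%N -> size G = d.+1) &
    forall n, T.[n + h] = T.[n] + T.[h] + h * G.[n]].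
Proof.
move=> T0 sT; pose G0 := \sum_(i < d.+1) h ^+ i *: T^`N(i.+1).
have taylor n : T.[n + h] = T.[n] + h * G0.[n].
  rewrite nderiv_taylor; last exact: mulrC.
  rewrite sT big_ord_recl nderivn0 expr0 mulr1; congr (_ + _).
  rewrite horner_sum mulr_sumr; apply: eq_bigr => i _.
  by rewrite hornerZ /bump /= exprS; ring.
have Th : T.[h] = h * G0.[0] by rewrite -[h in LHS]add0r taylor T0 add0r.
have coefG0 i : G0`_i =
    \sum_(k < d.+1) h ^+ k * (T`_(k.+1 + i) *+ 'C(k.+1 + i, k.+1)).
  by rewrite coef_sum; apply: eq_bigr => k _; rewrite coefZ coef_nderivn.
pose G := G0 - G0.[0]%:P.
have coefG i : (0 < i)%N -> G`_i = G0`_i.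
  by move=> i0; rewrite coefB coefC gtn_eqF // subr0.
have sG : (size G <= d.+1)%N.
  apply/leq_sizeP => i di; rewrite coefG ?(leq_trans _ di) // coefG0.
  apply: big1 => k _; rewrite nth_default ?mul0rn ?mulr0 // sT.
  by rewrite addSn !ltnS (leq_trans di) ?leq_addl.
exists G; split=> //; first by rewrite !hornerE subrr.
  move=> d0; apply/eqP; rewrite eqn_leq sG ltnNge; apply/negP.
  move/leq_sizeP/(_ d (leqnn _)) => /eqP; apply/negP.
  rewrite coefG // coefG0 big_ord_recl big1 => [|k _].
    rewrite addr0 expr0 mul1r add1n bin1 mulrn_eq0 /=.
    rewrite -[d.+1]/(d.+2.-1) -sT -lead_coefE.
    by rewrite lead_coef_eq0 -size_poly_eq0 sT.
  by rewrite nth_default ?mul0rn ?mulr0 // sT /bump /= addSn !ltnS leq_addl.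
by move=> n; rewrite taylor Th !hornerE; ring.
Qed.

Section Orbits.
Variables (R : realType) (H : hilbertType R) (U : unitary_op H).

Definition act (k : int) (x : H) : H := gexpz U k x.

Lemma actD j k x : act (j + k) x = act j (act k x).
Proof. by rewrite /act gexpzD. Qed.

Lemma act0 x : act 0 x = x. Proof. by []. Qed.

Lemma actNK k x : act k (act (- k) x) = x.
Proof. by rewrite -actD subrr. Qed.

Lemma act_linear k (a : R[i]) x y : act k (a *: x + y) = a *: act k x + act k y.
Proof. exact: op_linear. Qed.

Lemma actDr k x y : act k (x + y) = act k x + act k y.
Proof. by rewrite -[x in LHS]scale1r act_linear scale1r. Qed.

Lemma actZ k (a : R[i]) x : act k (a *: x) = a *: act k x.
Proof.
have act0r : act k 0 = 0 by apply: (addrI (act k 0)); rewrite -actDr !addr0.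
by rewrite -[a *: x]addr0 act_linear act0r addr0.
Qed.

Lemma rinner_act k x y : rinner (act k x) (act k y) = rinner x y.
Proof.
rewrite /rinner /act; set V := gexpz U k; have [B [adjVB _ BV]] := uopP V.
by rewrite adjVB -[B (V y)]/(opM B V y) BV.
Qed.

Lemma rinner_actl k x y : rinner (act k x) y = rinner x (act (- k) y).
Proof. by rewrite -[y in LHS](actNK k) rinner_act. Qed.

Lemma sqn_act k x : sqn (act k x) = sqn x.
Proof. exact: rinner_act. Qed.

End Orbits.

(** * Weak limits along polynomial orbits *)

Section WeakLimits.
Variables (R : realType) (H : hilbertType R) (U : unitary_op H).
Variables (p : set_system posN) (up : UltraFilter p).
Implicit Types (x y z v : H) (T Q G : {poly int}) (k : int).

Definition orb Q (n : posN) x := act U Q.[(val n)%:Z] x.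

(** The graph of the weak limit of the operators [U^(Q(n))]: it is total by
    [wlim_ex] and functional by [wlim_uniq]. *)
Definition wlim Q x y :=
  forall z, rinner (orb Q n x) z @[n --> p] --> rinner y z.
Definition rigid Q x := wlim Q x x.
Definition null Q x := wlim Q x 0.

Lemma small_pairing (M : R) (w v : posN -> H) :
  sqn (w n) @[n --> p] --> (0 : R) -> (forall n, sqn (v n) <= M) ->
  rinner (w n) (v n) @[n --> p] --> (0 : R).
Proof.
move=> sw vM; apply/cvgrPdist_lt => e e0.
have q1 : 0 < M + 1.
  have := vM (exist _ 1%N isT); have := sqn_ge0 (v (exist _ 1%N isT)); lra.
have d0 : 0 < e ^+ 2 / (M + 1) by rewrite divr_gt0 ?exprn_gt0.
move/cvgrPdist_lt: sw => /(_ _ d0); apply: filterS => n.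
rewrite sub0r normrN ger0_norm ?sqn_ge0 // ltr_pdivlMr // => swn.
rewrite sub0r normrN -ltr_sqr ?nnegrE // ?(ltW e0) //.
rewrite real_normK ?num_real //; apply: le_lt_trans (cauchy_schwarz _ _) _.
by have := sqn_ge0 (w n); have := vM n; nra.
Qed.

Lemma wlim_ex Q x : exists y, wlim Q x y.
Proof.
have bnd z : exists L : R, rinner (orb Q n x) z @[n --> p] --> L.
  apply: (@ultra_bounded_cvg _ _ _ (1 + sqn x * sqn z)) => n.
  rewrite ler_norml; have := cauchy_schwarz (orb Q n x) z; rewrite sqn_act.
  move: (rinner _ _) => r h.
  have := sqr_ge0 (r - 1); have := sqr_ge0 (r + 1); nra.
have [f fP] := choice bnd.
have fD z v : f (z + v) = f z + f v.
  have : rinner (orb Q n x) (z + v) @[n --> p] --> f z + f v.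
    by under eq_fun do rewrite rinnerDr; exact: cvgD.
  exact: (cvg_unique (@Rhausdorff R) (fP _)).
have fZ (a : R) z : f (a%:C%C *: z) = a * f z.
  have : rinner (orb Q n x) (a%:C%C *: z) @[n --> p] --> a * f z.
    by under eq_fun do rewrite rinnerZr; exact: cvgMr.
  exact: (cvg_unique (@Rhausdorff R) (fP _)).
have fC z : f z ^+ 2 <= sqn x * sqn z.
  have sq : rinner (orb Q n x) z ^+ 2 @[n --> p] --> f z ^+ 2.
    by rewrite expr2; under eq_fun do rewrite expr2; exact: cvgM.
  apply: (cvgr_to_le sq); apply: filterE => n.
  rewrite -(sqn_act U Q.[(val n)%:Z] x); exact: cauchy_schwarz.
have [] := @riesz_adherent R H setT f (sqn x) => //; first exact: sqn_ge0.
by move=> y _ yP; exists y => z; rewrite -yP.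
Qed.

Lemma wlim_uniq Q x y y' : wlim Q x y -> wlim Q x y' -> y = y'.
Proof.
move=> xy xy'; apply/eqP; rewrite -subr_eq0; apply/eqP/sqn_eq0.
rewrite /sqn rinnerDl rinnerNl.
by rewrite (cvg_unique (@Rhausdorff R) (xy (y - y')) (xy' (y - y'))) ?subrr.
Qed.

Lemma wlimD Q x y x' y' :
  wlim Q x y -> wlim Q x' y' -> wlim Q (x + x') (y + y').
Proof.
move=> xy xy' z; rewrite rinnerDl.
by under eq_fun do rewrite /orb actDr rinnerDl; apply: cvgD.
Qed.

Lemma wlimZ Q (a : R) x y : wlim Q x y -> wlim Q (a%:C%C *: x) (a%:C%C *: y).
Proof.
move=> xy z; rewrite rinnerZl.
by under eq_fun do rewrite /orb actZ rinnerZl; apply: cvgMr.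
Qed.

Lemma wlimB Q x y x' y' :
  wlim Q x y -> wlim Q x' y' -> wlim Q (x - x') (y - y').
Proof.
move=> xy /(@wlimZ Q (-1)) xy'; have := wlimD xy xy'.
by rewrite rmorphN1 !scaleN1r.
Qed.

Lemma wlim_act Q k x y : wlim Q x y -> wlim Q (act U k x) (act U k y).
Proof.
move=> xy z; rewrite rinner_actl; under eq_fun do
  rewrite /orb -actD addrC actD rinner_actl.
exact: xy.
Qed.

Lemma wlim_sqn Q x y : wlim Q x y -> sqn y <= sqn x.
Proof.
move=> /(_ y) xy; have : sqn y <= (sqn x + sqn y) / 2.
  apply: (cvgr_to_le xy).
  apply: filterE => n; have := sqn_ge0 (orb Q n x - y).
  rewrite sqnB sqn_act; lra.
lra.
Qed.

(** For an orbit of constant length, weak and norm convergence to [x] agree. *)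
Lemma rigidP Q x : rigid Q x <-> sqn (orb Q n x - x) @[n --> p] --> (0 : R).
Proof.
split=> [rx | sx z].
  under eq_fun do rewrite sqnB sqn_act.
  have -> : 0 = sqn x - 2 * sqn x + sqn x by ring.
  apply: cvgD (cvg_cst _); apply: cvgB; first exact: cvg_cst.
  by apply: cvgMr; exact: rx.
rewrite -[rinner x z]add0r.
under eq_fun => n do rewrite -[orb Q n x](subrK x) rinnerDl.
by apply: cvgD (cvg_cst _); exact: (@small_pairing (sqn z)).
Qed.

Lemma rigid_pairing Q x (M : R) (v : posN -> H) : rigid Q x ->
  (forall n, sqn (v n) <= M) ->
  rinner (orb Q n x - x) (v n) @[n --> p] --> (0 : R).
Proof. by move=> /rigidP; exact: small_pairing. Qed.

Lemma rigidD Q T x : rigid Q x -> rigid T x -> rigid (Q + T) x.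
Proof.
move=> Qx Tx z; rewrite -[rinner x z]add0r.
under eq_fun => n do rewrite /orb hornerD actD -[act U T.[_] x](subrK x)
  actDr rinnerDl [X in X + _]rinner_actl.
apply: cvgD (Qx z); apply: (@rigid_pairing T x (sqn z)) => // n.
by rewrite sqn_act.
Qed.

Lemma rigidN Q x : rigid Q x -> rigid (- Q) x.
Proof.
move=> Qx z; rewrite -[rinner x z]addr0 -oppr0.
have -> : (fun n => rinner (orb (- Q) n x) z) =
   fun n => rinner x z - rinner (orb Q n x - x) (orb Q n z).
  apply/funext => n; rewrite rinnerDl rinnerNl rinner_act opprB addrC.
  by rewrite subrK /orb hornerN rinner_actl opprK.
apply: cvgB; first exact: cvg_cst.
by apply: (@rigid_pairing Q x (sqn z)) => // n; rewrite sqn_act.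
Qed.

Lemma rigid0 x : rigid 0 x.
Proof.
by move=> z; under eq_fun do rewrite /orb horner0 act0; exact: cvg_cst.
Qed.

Lemma rigidZ k Q x : rigid Q x -> rigid (k *: Q) x.
Proof.
move=> Qx; have nat_case n : rigid (n%:Z *: Q) x.
  elim: n => [|n IH]; first by rewrite scale0r; exact: rigid0.
  by rewrite intS scalerDl scale1r; exact: rigidD.
by case: k => n //; rewrite NegzE scaleNr; exact: rigidN.
Qed.

(** The weak limit operator of [T] is a contraction commuting with [U], so it
    does not increase the length of [U^(Q(n)) x - x]. *)
Lemma rigid_wlim Q T x y : rigid Q x -> wlim T x y -> rigid Q y.
Proof.
move=> /rigidP Qx xy; apply/rigidP.
apply: squeeze_cvgr (cvg_cst 0) Qx; apply: filterE => n; rewrite sqn_ge0 /=.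
by apply: (@wlim_sqn T); apply: wlimB => //; exact: wlim_act.
Qed.

(** Along [p], a limit in [n] is an iterated limit in [h] and then [n] of the
    values at [n + h].  For [l] dividing [h], the correction [h G] to
    [T(n) + T(h)] is a multiple of [l G], for which [x] is rigid; hence the
    inner limit of [U^(T(n + h)) x] is [U^(T(h)) y], and the outer one must be
    [y]. *)
Lemma wlim_idempotent (ip : idempotent_uf p) T x y (l d : nat) :
  T.[0] = 0 -> size T = d.+2 -> (0 < l)%N ->
  (forall G, G.[0] = 0 -> (size G <= d.+1)%N -> rigid (l%:Z *: G) x) ->
  wlim T x y -> rigid T y.
Proof.
move=> T0 sT l0 rx xy z; apply/cvgrPdist_lt => e e0.
have e4 : 0 < e / 4 by lra.
move/cvgrPdist_lt: (xy z) => /(_ _ e4) /(idempotent_near ip) near_sum.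
apply: filterS2 near_sum (idempotent_dvdn up ip l0) => h hn /dvdnP[c hc].
have [G [G0 sG _ GE]] := poly_shift (val h)%:Z T0 sT.
have rG : rigid ((val h)%:Z *: G) x.
  by rewrite hc PoszM -scalerA; apply: rigidZ; exact: rx.
have lim_h : rinner (orb T (addp n h) x) z @[n --> p] --> rinner (orb T h y) z.
  rewrite rinner_actl -[rinner y _]add0r.
  have -> : (fun n => rinner (orb T (addp n h) x) z) = fun n =>
    rinner (orb ((val h)%:Z *: G) n x - x)
      (act U (- T.[(val n)%:Z]) (act U (- T.[(val h)%:Z]) z)) +
    rinner (orb T n x) (act U (- T.[(val h)%:Z]) z).
    apply/funext => n.
    rewrite -[in RHS]rinner_actl /orb -[RHS]rinnerDl -actDr subrK.
    rewrite -actD -rinner_actl -actD PoszD GE hornerZ.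
    by congr (rinner (act _ _ _) _); ring.
  apply: cvgD (xy _); apply: (@rigid_pairing _ x (sqn z)) => // n.
  by rewrite !sqn_act.
move/cvgrPdist_lt: lim_h => /(_ _ e4) /(filterI hn) /filter_ex[n [] /=].
rewrite !ltr_norml => /andP[a1 a2] /andP[b1 b2].
by apply/andP; split; lra.
Qed.

End WeakLimits.

(** * The filtration by degree of rigidity *)

Section RigidFiltration.
Variables (R : realType) (H : hilbertType R) (U : unitary_op H).
Variables (p : set_system posN) (up : UltraFilter p) (ip : idempotent_uf p).
Implicit Types (x y z v : H) (T Q G P : {poly int}) (j d : nat).

Local Notation rigid := (rigid U p).
Local Notation null := (null U p).
Local Notation wlim := (wlim U p).
Local Notation orb := (orb U).

(** A common multiplier [l] is asked for all [G] so that these sets are vector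
    spaces and are insensitive to passing to multiples; they need not be closed,
    whence the use of [adherent] below. *)
Definition level j : set H := [set x | exists l : nat, (0 < l)%N /\
  forall G, G.[0] = 0 -> (size G <= j.+1)%N -> rigid (l%:Z *: G) x].

Lemma levelD j x y : level j x -> level j y -> level j (x + y).
Proof.
move=> [l [l0 lx]] [m [m0 my]]; exists (l * m)%N; split=> [|G G0 sG].
  by rewrite muln_gt0 l0.
by apply: wlimD; rewrite PoszM; [rewrite mulrC -scalerA | rewrite -scalerA];
  apply: rigidZ => //; [exact: lx | exact: my].
Qed.

Lemma levelZ j (a : R) x : level j x -> level j (a%:C%C *: x).
Proof.
move=> [l [l0 lx]]; exists l; split=> // G G0 sG.
by apply: wlimZ; exact: lx.
Qed.

Lemma level_act j k x : level j x -> level j (act U k x).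
Proof.
move=> [l [l0 lx]]; exists l; split=> // G G0 sG.
by apply: wlim_act; exact: lx.
Qed.

Lemma level_zero j : level j 0.
Proof.
exists 1%N; split=> // G _ _ z; rewrite rinner0l; under eq_fun do
  rewrite rinner_actl rinner0l.
exact: cvg_cst.
Qed.

Lemma level_decr j x : level j.+1 x -> level j x.
Proof.
move=> [l [l0 lx]]; exists l; split=> // G G0 sG; apply: lx => //.
exact: leq_trans sG _.
Qed.

Lemma level0 x : level 0 x.
Proof.
exists 1%N; split=> // G G0 /size1_polyC GC.
by move: G0; rewrite GC hornerC => ->; rewrite polyC0 scaler0; exact: rigid0.
Qed.

(** [y] is rigid for [T], and like [x] for the multiples by [l] of polynomials
    of degree at most [d].  With [b] the leading coefficient of [T], subtracting
    a multiple of [T] from [b G] lowers the degree to [d]. *)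
Lemma level_wlim d T x y : T.[0] = 0 -> size T = d.+2 ->
  level d x -> wlim T x y -> level d.+1 y.
Proof.
move=> T0 sT [l [l0 lx]] xy; have Ty := wlim_idempotent up ip T0 sT l0 lx xy.
pose b := T`_d.+1.
have b0 : b != 0.
  rewrite /b -[d.+1]/(d.+2.-1) -sT -lead_coefE.
  by rewrite lead_coef_eq0 -size_poly_eq0 sT.
exists (l * `|b|)%N; split=> [|G G0 sG]; first by rewrite muln_gt0 l0 absz_gt0.
have -> : (l * `|b|)%:Z *: G =
    sgz b *: (l%:Z *: (b *: G - G`_d.+1 *: T) + (l%:Z * G`_d.+1) *: T).
  rewrite scalerBr scalerA scalerA scalerDr scalerBr !scalerA subrK PoszM.
  by rewrite abszEsg; congr (_ *: _); ring.
apply: rigidZ => //; apply: rigidD => //; last exact: rigidZ.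
apply: (rigid_wlim up _ xy); apply: lx.
  by rewrite hornerD hornerN !hornerZ G0 T0 !mulr0 subrr.
apply/leq_sizeP => i; rewrite leq_eqVlt => /predU1P[<-|di].
  by rewrite coefB !coefZ /b mulrC subrr.
rewrite coefB 2!coefZ [G`_i]nth_default ?(leq_trans sG) //.
by rewrite [T`_i]nth_default ?sT // !mulr0 subrr.
Qed.

(** The weak limit [y] of [U^(T(n)) x] is adherent to [level d.+1] by
    [level_wlim] and orthogonal to it because that space is invariant under [U];
    so [y = 0]. *)
Lemma orthogonal_null d T x : T.[0] = 0 -> size T = d.+2 ->
  adherent (level d) x -> (forall z, level d.+1 z -> rinner x z = 0) ->
  null T x.
Proof.
move=> T0 sT ax ox; have [y xy] := wlim_ex U up T x.
suff /sqn_eq0 y0 : sqn y = 0 by rewrite y0 in xy.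
have oy z : level d.+1 z -> rinner y z = 0.
  move=> zl; apply: (cvg_unique (@Rhausdorff R) (xy z)).
  have -> : (fun n => rinner (orb T n x) z) = fun=> 0.
    by apply/funext => n; rewrite rinner_actl ox //; exact: level_act.
  exact: cvg_cst.
apply/eqP; rewrite eq_le sqn_ge0 andbT; apply/ler_addgt0Pr => e e0.
have [v vl xv] := ax e e0; have [w vw] := wlim_ex U up T v.
have := wlim_sqn up (wlimB up xy vw).
rewrite [X in X <= _]sqnB oy; last exact: level_wlim T0 sT vl vw.
by have := sqn_ge0 w; lra.
Qed.

(** Van der Corput's trick: the correlations of [U^(T(n)) x] with its translates
    only involve the differences [T(n + h) - T(n)], of degree one less. *)
Lemma null_succ d x :
  (forall T, T.[0] = 0 -> size T = d.+2 -> null T x) ->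
  forall T, T.[0] = 0 -> size T = d.+3 -> null T x.
Proof.
move=> nx T T0 sT z; rewrite rinner0l.
apply: (@van_der_corput _ _ _ up ip (fun n => orb T n x) (sqn x)) => [n|h].
  by rewrite sqn_act.
have [G [G0 _ sG GE]] := poly_shift (val h)%:Z T0 sT.
have h0 : (val h)%:Z != 0 by rewrite eqz_nat -lt0n; exact: valP h.
have -> : (fun n => rinner (orb T (addp n h) x) (orb T n x)) =
    fun n => rinner (orb ((val h)%:Z *: G) n x) (act U (- T.[(val h)%:Z]) x).
  apply/funext => n.
  rewrite -[RHS]rinner_actl -[RHS](rinner_act U T.[(val n)%:Z]).
  by rewrite /orb -!actD /= PoszD GE hornerZ.
have nG : null ((val h)%:Z *: G) x.
  by apply: nx; rewrite ?hornerZ ?G0 ?mulr0 // size_scale // sG.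
by have := nG (act U (- T.[(val h)%:Z]) x); rewrite rinner0l.
Qed.

Lemma null_above d x :
  (forall T, T.[0] = 0 -> size T = d.+2 -> null T x) ->
  forall T, T.[0] = 0 -> (d.+1 < size T)%N -> null T x.
Proof.
move=> nx T T0 sT; have [k sTk] : exists k, size T = (d + k).+2.
  by exists (size T - d.+2)%N; lia.
elim: k T T0 {sT} sTk => [|k IH] T T0; first by rewrite addn0; exact: nx.
by rewrite addnS; apply: null_succ T0.
Qed.

(** By descending induction on [j], a vector adherent to [level j] is null for
    [Q]: it is the sum of its projection on the closure of [level j.+1] and of a
    vector to which [orthogonal_null] and [null_above] apply. *)
Lemma adherent_level_null N Q : Q.[0] = 0 -> (N < size Q)%N ->
  (forall x, level N x -> x = 0) -> forall x, null Q x.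
Proof.
move=> Q0 sQ levelN.
suff desc k j : (j + k = N)%N -> forall x, adherent (level j) x -> null Q x.
  move=> x; apply: (desc N 0%N) => // e e0; exists x; first exact: level0.
  by rewrite subrr /sqn rinner0l.
elim: k j => [|k IH] j jk x ax.
  have -> : x = 0; last first.
    move=> z; rewrite rinner0l; under eq_fun do rewrite rinner_actl rinner0l.
    exact: cvg_cst.
  apply/sqn_eq0/eqP; rewrite eq_le sqn_ge0 andbT; apply/ler_addgt0Pr => e e0.
  have [v vl] := ax e e0; rewrite addn0 in jk; rewrite jk in vl.
  by rewrite (levelN v vl) subr0 => /ltW; rewrite add0r.
have [|||||||a aa aP] := @riesz_adherent _ _ (level j.+1) (rinner x) (sqn x).
- exact: level_zero.
- exact: levelD.
- exact: levelZ.
- by move=> *; rewrite rinnerDr.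
- by move=> *; rewrite rinnerZr.
- exact: sqn_ge0.
- by move=> v _; exact: cauchy_schwarz.
have ab : adherent (level j) (x - a).
  move=> e e0; have e4 : 0 < e / 4 by lra.
  have [v vl xv] := ax _ e4; have [w wl aw] := aa _ e4.
  exists (v - w).
    apply: levelD => //; rewrite -scaleN1r -[- 1](rmorphN1 (real_complex R)).
    by apply: levelZ; exact: level_decr.
  have -> : x - a - (v - w) = (x - v) - (a - w).
    by rewrite !opprB addrACA [RHS]addrACA [- a - v]addrC.
  have := sqnD_le (x - v) (- (a - w)); rewrite sqnN; lra.
suff sum : wlim Q (x - a + a) (0 + 0) by rewrite subrK addr0 in sum.
apply: wlimD; last by apply: IH aa; lia.
apply: (@null_above j) => //; last by lia.
move=> T T0 sT; apply: (@orthogonal_null j) => // z zl.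
by rewrite rinnerDl rinnerNl -aP // subrr.
Qed.

End RigidFiltration.

(** * The weak operator topology *)

Lemma initial_cvgP (S : choiceType) (T : topologicalType) (f : S -> T)
    (F : set_system S) (s : S) : Filter F ->
  F --> (s : initial_topology f) <-> f @ F --> f s.
Proof.
move=> FF; split=> [Fs|fFs].
  exact: cvg_comp Fs (@initial_continuous _ _ f s).
move=> A; rewrite nbhsE => -[_ [[B oB <-] Bs] BA].
by apply: filterS BA _; apply: fFs; exact: open_nbhs_nbhs.
Qed.

Section WeakOperatorTopology.
Variables (R : realType) (H : hilbertType R).
Variables (p : set_system posN) (up : UltraFilter p).

Lemma inner_rinner (x y : H) :
  inner x y = (rinner x y +i* rinner x ('i%C *: y))%C.
Proof.
have -> : rinner x ('i%C *: y) = complex.Im (inner x y).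
  rewrite rinnerC /rinner -['i%C *: y]addr0 inner_linearl [inner x y]inner_conj.
  have : rinner (0 : H) x = 0 by exact: rinner0l.
  rewrite /rinner; case: (inner 0 x) => u v /= ->; case: (inner y x) => a b /=.
  by ring.
by rewrite /rinner; case: (inner x y).
Qed.

(** Real parts suffice, since replacing [z] by ['i *: z] recovers imaginary
    parts. *)
Lemma plim_op0P (F : posN -> bounded_op H) :
  plim p (F : posN -> wot H) op0 <->
  forall x z, rinner (F n x) z @[n --> p] --> (0 : R).
Proof.
rewrite plimP.
have -> : ((F : posN -> wot H) @ p --> (op0 : wot H)) <->
    (@matrix_coef R H \o F) @ p --> matrix_coef (op0 : bounded_op H).
  exact: initial_cvgP.
have -> : (@matrix_coef R H \o F) @ p --> matrix_coef (op0 : bounded_op H) <->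
    forall xz, matrix_coef (F n) xz @[n --> p] --> matrix_coef (@op0 R H) xz.
  exact: pointwise_cvgP.
split=> [cF x z|cF [x z]].
  apply/cvgrPdist_lt => e e0.
  have := cF (x, z) => /cvgrPdist_lt /(_ e%:C%C); rewrite (ltcR 0) => /(_ e0).
  apply: filterS => n; rewrite /matrix_coef /=.
  rewrite !inner_rinner !rinner0l sub0r normrN sub0r normrN => h.
  rewrite -ltcR; apply: le_lt_trans h.
  rewrite normc_def lecR -sqrtr_sqr ler_wsqrtr //= lerDl; exact: sqr_ge0.
apply/cvgrPdist_lt => e e0.
have [d d0 ->] : exists2 d : R, 0 < d & e = d%:C%C.
  exists (complex.Re e); first by move: e0; rewrite ltcE => /andP[].
  by rewrite RRe_real // gtr0_real.
have d2 : 0 < d / 2 by rewrite divr_gt0.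
have /cvgrPdist_lt /(_ _ d2) c1 := cF x z.
have /cvgrPdist_lt /(_ _ d2) c2 := cF x ('i%C *: z).
apply: filterS2 c1 c2 => n; rewrite !sub0r !normrN /matrix_coef /= => h1 h2.
rewrite !inner_rinner !rinner0l sub0r normrN normc_def ltcR /=.
rewrite -[ltRHS]ger0_norm ?(ltW d0) // -sqrtr_sqr ltr_sqrt ?exprn_gt0 //.
move: h1 h2; rewrite !ltr_norml => /andP[a1 a2] /andP[b1 b2]; nra.
Qed.

End WeakOperatorTopology.

Theorem corollaryB (R : realType) (H : hilbertType R) (sepH : separable H)
  (U : unitary_op H) (p : set_system posN) (ultra_p : UltraFilter p)
  (idem_p : idempotent_uf p) (N : nat) (N_ge1 : (1 <= N)%N)
  (P : {poly int}) (P0 : P.[0] = 0) (degP : size P = N.+1)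
  (limP : forall l : nat, (1 <= l)%N ->
    plim p (fun n : posN => gexpz U (l%:Z * P.[(val n)%:Z]) : wot H) op0) :
  forall Q : {poly int}, poly_ge N Q ->
    plim p (fun n : posN => gexpz U Q.[(val n)%:Z] : wot H) op0.
Proof.
move=> Q [Q0 sQ]; apply/plim_op0P => x z; rewrite -(rinner0l z).
apply: (adherent_level_null ultra_p idem_p Q0 sQ) => {x z} x [l [l0 lx]].
have rx : rigid U p (l%:Z *: P) x by apply: lx; rewrite ?degP.
apply: (wlim_uniq ultra_p rx) => z; rewrite rinner0l.
have /plim_op0P /(_ x z) := limP l l0.
by under eq_fun do rewrite -hornerZ.
Qed.
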